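(* Let $N\ge1$ be an integer and assume that $1\le p<\infty$. Let $1\le q\le\infty$. If there exists a constant $C$ such that $$\left[\frac{u(x)-u(y)}{|x-y|^{\frac{N+1}{p}}}\right]_{L^{p,q}(\mathbb{R}^N\times\mathbb{R}^N)}\le C\,\|u\|_{L^\infty(\mathbb{R}^N)}^{1-\frac1p}\,\|\nabla u\|_{L^1(\mathbb{R}^N)}^{\frac1p}\qquad\text{for all }u\in C_c^\infty(\mathbb{R}^N),$$ then $q=\infty$.
   Context: $C_c^\infty(\mathbb{R}^N)$ is the space of real-valued smooth compactly supported functions on $\mathbb{R}^N$, and $\mathcal{L}^{2N}$ is Lebesgue measure on $\mathbb{R}^N\times\mathbb{R}^N$. For a measurable function $f$ on $\mathbb{R}^N\times\mathbb{R}^N$ and $1\le p<\infty$, the Lorentz quasi-norm is defined, when $1\le q<\infty$, by $$[f]_{L^{p,q}(\mathbb{R}^N\times\mathbb{R}^N)}^q=p\int_0^\infty\lambda^q\,\mathcal{L}^{2N}\bigl(\{(x,y)\in\mathbb{R}^N\times\mathbb{R}^N:\ |f(x,y)|\ge\lambda\}\bigr)^{\frac{q}{p}}\frac{d\lambda}{\lambda},$$ and, when $q=\infty$, by $$[f]_{L^{p,\infty}(\mathbb{R}^N\times\mathbb{R}^N)}^p=\sup_{\lambda>0}\lambda^p\,\mathcal{L}^{2N}\bigl(\{(x,y)\in\mathbb{R}^N\times\mathbb{R}^N:\ |f(x,y)|\ge\lambda\}\bigr).$$ The quotient in the claim is regarded as a function of $(x,y)$, defined for $x\ne y$. The constant $C$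 does not depend on $u$. For $p=1$ the factor $\|u\|_{L^\infty}^0$ is $1$. *)

(* Defs.v *)
From HB Require Import structures.
From mathcomp Require Import all_boot all_order all_algebra.
From mathcomp Require Import all_classical all_reals all_analysis.

Set Implicit Arguments.
Unset Strict Implicit.
Unset Printing Implicit Defensive.
Import Order.TTheory GRing.Theory Num.Theory.
Import numFieldNormedType.Exports.

Local Open Scope classical_set_scope.
Local Open Scope ring_scope.

Section measurable_rV.
Context {d} {T : measurableType d} (n : nat).

Let coors : 'I_n -> 'rV[T]_n -> T := fun i v => v ord0 i.

Let rV_set0 : g_sigma_preimage coors set0.
Proof. exact: sigma_algebra0. Qed.

Let rV_setC A : g_sigma_preimage coors A -> g_sigma_preimage coors (~` A).
Proof. exact: sigma_algebraC. Qed.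

Let rV_bigcup (F : (set 'rV[T]_n)^nat) :
  (forall i, g_sigma_preimage coors (F i)) ->
  g_sigma_preimage coors (\bigcup_i (F i)).
Proof. exact: sigma_algebra_bigcup. Qed.

(* The product sigma-algebra on row vectors; it is the Borel one for T = R. *)
HB.instance Definition _ := @isMeasurable.Build (measure_tuple_display d)
  'rV[T]_n (g_sigma_preimage coors) rV_set0 rV_setC rV_bigcup.

Lemma measurable_coord (i : 'I_n) :
  measurable_fun [set: 'rV[T]_n] (fun v : 'rV[T]_n => v ord0 i).
Proof.
move=> _ Y mY; rewrite setTI; apply: sub_sigma_algebra => /=.
rewrite -bigcup_seq/=; exists i => /=; first by rewrite mem_index_enum.
by exists Y => //; rewrite setTI.
Qed.

Lemma measurable_fun_coordP d' (T' : measurableType d') (f : T' -> 'rV[T]_n) :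
  measurable_fun [set: T'] f <->
  forall i, measurable_fun [set: T'] (fun x => f x ord0 i).
Proof.
split=> [mf i|mf].
  exact: (measurableT_comp (measurable_coord i) mf).
move=> _ Y; rewrite setTI; move: Y.
apply: smallest_sub.
  split=> /=.
  - by rewrite preimage_set0.
  - by move=> A mA; rewrite setTD preimage_setC; exact: measurableC.
  - by move=> F mF; rewrite preimage_bigcup; exact: bigcup_measurable.
rewrite -bigcup_seq/= => A [i _ [B mB <-]].
by rewrite setTI -[X in measurable X]setTI; exact: mf.
Qed.

End measurable_rV.

Section lebesgue_rV.
Context {R : realType}.

Definition cons_rV n (z : R * 'rV[R]_n) : 'rV[R]_n.+1 :=
  row_mx (const_mx z.1 : 'rV[R]_1) z.2.

Lemma measurable_cons_rV n : measurable_fun [set: R * 'rV[R]_n] (@cons_rV n).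
Proof.
apply/measurable_fun_coordP => i; rewrite /cons_rV.
under eq_fun do rewrite mxE.
case: fintype.split => j; first by under eq_fun do rewrite mxE; exact: measurable_fst.
exact: (measurableT_comp (measurable_coord j) measurable_snd).
Qed.

Let split_rV n (v : 'rV[R]_n.+1) : R * 'rV[R]_n :=
  (v ord0 ord0, rsubmx (v : 'rV[R]_(1 + n))).

Let split_rVK n : cancel (@split_rV n) (@cons_rV n).
Proof.
move=> v; apply/rowP => i; rewrite /split_rV /cons_rV mxE.
case: (@fintype.splitP 1 n i) => j ij; rewrite !mxE; congr (v _ _);
  apply/val_inj => /=; rewrite ij//.
by rewrite ord1.
Qed.

Let cons_rVK n : cancel (@cons_rV n) (@split_rV n).
Proof.
move=> [x v]; rewrite /split_rV /cons_rV/=; congr pair; last first.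
  exact: (@row_mxKr _ 1 1 n).
by rewrite mxE; case: (@fintype.splitP 1 n ord0) => j //= _; rewrite mxE.
Qed.

Let measurable_split_rV n : measurable_fun [set: 'rV[R]_n.+1] (@split_rV n).
Proof.
apply: measurable_fun_pair; first exact: measurable_coord.
apply/measurable_fun_coordP => i; under eq_fun do rewrite mxE.
exact: measurable_coord.
Qed.

Section step.
Context n (mu : {sigma_finite_measure set 'rV[R]_n -> \bar R}).

Definition lebesgue_step : set 'rV[R]_n.+1 -> \bar R :=
  pushforward (@lebesgue_measure R \x mu)%E (@cons_rV n).

Let step0 : lebesgue_step set0 = 0%E.
Proof. by rewrite /lebesgue_step /pushforward preimage_set0 measure0. Qed.

Let step_ge0 A : (0 <= lebesgue_step A)%E.
Proof. exact: (measure_ge0 (@lebesgue_measure R \x mu)%E). Qed.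

Let step_sigma_additive : semi_sigma_additive lebesgue_step.
Proof.
have mcons := @measurable_cons_rV n.
move=> F mF tF mUF; rewrite /lebesgue_step /pushforward preimage_bigcup.
apply: measure_semi_sigma_additive.
- by move=> k; rewrite -[X in measurable X]setTI; exact: mcons.
- apply/trivIsetP => /= i j _ _ ij; rewrite -preimage_setI.
  by move/trivIsetP : tF => /(_ _ _ _ _ ij) ->//; rewrite preimage_set0.
- by rewrite -preimage_bigcup -[X in measurable X]setTI; exact: mcons.
Qed.

HB.instance Definition _ := isMeasure.Build _ _ _ lebesgue_step
  step0 step_ge0 step_sigma_additive.

Let step_sigma_finite : sigma_finite setT lebesgue_step.
Proof.
pose lam : {sigma_finite_measure set (measurableTypeR R) -> \bar R} :=
  lebesgue_measure.
have /sigma_finiteP[F [TF ndF Foo]] := sigma_finiteT lam.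
have /sigma_finiteP[G [TG ndG Goo]] := sigma_finiteT mu.
exists (fun k => @split_rV n @^-1` (F k `*` G k)).
  rewrite predeqE => v; split=> // _.
  have [k _ Fk] : (\bigcup_k F k) (split_rV v).1 by rewrite -TF.
  have [l _ Gl] : (\bigcup_k G k) (split_rV v).2 by rewrite -TG.
  exists (maxn k l) => //; split.
  - by apply: (subsetPset _ _ (ndF _ _ (leq_maxl k l))).
  - by apply: (subsetPset _ _ (ndG _ _ (leq_maxr k l))).
move=> k; have [mF Fk] := Foo k; have [mG Gk] := Goo k; split.
  rewrite -[X in measurable X]setTI; apply: measurable_split_rV => //.
  exact: measurableX.
rewrite /lebesgue_step /pushforward -comp_preimage.
rewrite (_ : _ \o _ = id) ?preimage_id; last first.
  by apply/funext => z /=; rewrite cons_rVK.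
by rewrite product_measure1E// lte_mul_pinfty// ge0_fin_numE.
Qed.

HB.instance Definition _ := Measure_isSigmaFinite.Build _ _ _ lebesgue_step
  step_sigma_finite.

End step.

Fixpoint lebesgue_rV n : {sigma_finite_measure set 'rV[R]_n -> \bar R} :=
  match n with
  | 0 => \d_(0 : 'rV[R]_0)
  | m.+1 => lebesgue_step (lebesgue_rV m)
  end.

Lemma lebesgue_rV_box n (A : 'I_n -> set (measurableTypeR R)) :
  (forall i, measurable (A i)) ->
  lebesgue_rV n [set v | forall i, A i (v ord0 i)] =
  (\prod_(i < n) lebesgue_measure (A i))%E.
Proof.
elim: n A => [|n IHn] A mA /=.
  rewrite big_ord0 diracE (_ : _ \in _)//.
  by apply/mem_set => -[].
rewrite /lebesgue_step /pushforward.
pose B : set 'rV[R]_n := [set v | forall i, A (lift ord0 i) (v ord0 i)].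
have mB : measurable B.
  rewrite (_ : B = \bigcap_(i in [set: 'I_n])
      (fun v : 'rV[R]_n => v ord0 i) @^-1` A (lift ord0 i)).
    apply: fin_bigcap_measurable => // i _.
    rewrite -[X in measurable X]setTI.
    exact: (@measurable_coord _ (measurableTypeR R) n i).
  by apply/seteqP; split=> v /= Bv i; [move=> _|]; exact: Bv.
rewrite (_ : _ @^-1` _ = A ord0 `*` B); last first.
  apply/seteqP; split=> -[x v] /=.
    move=> Axv; split; rewrite /B/=.
      move: (Axv ord0); rewrite mxE.
      by case: (@fintype.splitP 1 n ord0) => j //= _; rewrite mxE.
    move=> i; move: (Axv (lift ord0 i)); rewrite mxE.
    case: (@fintype.splitP 1 n (lift ord0 i)) => [[[|//] ?]|j /= /eqP] //.
    by rewrite /bump/= eqSS => /eqP/val_inj <-.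
  move=> [A0 Bv] i; rewrite mxE.
  case: (@fintype.splitP 1 n i) => j ij.
    by rewrite mxE (_ : i = ord0)//; apply/val_inj; rewrite /= ij ord1.
  by rewrite (_ : i = lift ord0 j) //; apply/val_inj.
by rewrite product_measure1E// big_ord_recl -IHn.
Qed.

End lebesgue_rV.

Section function_spaces.
Context {R : realType} {N : nat}.
Implicit Types (u : 'rV[R]_N -> R) (v : 'rV[R]_N).

Definition partial (i : 'I_N) u : 'rV[R]_N -> R :=
  fun x => 'D_(delta_mx ord0 i) u x.

Fixpoint C_k (k : nat) u : Prop :=
  match k with
  | 0 => continuous u
  | k'.+1 => continuous u /\
      forall i, (forall x, derivable u x (delta_mx ord0 i)) /\ C_k k' (partial i u)
  end.

Definition smooth u : Prop := forall k, C_k k u.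

Definition Cc_infty : set ('rV[R]_N -> R) :=
  [set u | smooth u /\ compact (closure [set x | u x != 0])].

Definition grad u x : 'rV[R]_N := \row_i partial i u x.

(* The library's norm on matrices is the sup norm. *)
Definition eucl_norm v : R := Num.sqrt (\sum_(i < N) v ord0 i ^+ 2).

(* On the diagonal, a null set, the value is 0. *)
Definition quotient (p : R) u (z : 'rV[R]_N * 'rV[R]_N) : R :=
  (u z.1 - u z.2) / (eucl_norm (z.1 - z.2)) `^ ((N%:R + 1) / p).

End function_spaces.

Section lorentz.
Context {d} {T : measurableType d} {R : realType}.
Local Open Scope ereal_scope.

(* Meaningful for 1 <= p and 1 <= q; the value at q = -oo is arbitrary. *)
Definition lorentz (mu : set T -> \bar R) (p : R) (q : \bar R) (f : T -> R)
    : \bar R :=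
  let level (l : R) := mu [set z | (l <= `|f z|)%R] in
  match q with
  | r%:E => (p%:E * \int[lebesgue_measure]_(l in `]0%R, +oo[)
               ((l `^ r)%:E * level l `^ (r / p) * (l^-1)%:E)) `^ r^-1
  | +oo => (ereal_sup [set (l `^ p)%:E * level l | l in `]0%R, +oo[]) `^ p^-1
  | -oo => 0
  end.

End lorentz.

(* Main.v *)
Require Import Defs.
From mathcomp Require Import all_boot all_order all_algebra.
From mathcomp Require Import all_classical all_reals all_analysis.
From mathcomp Require Import measurable_realfun ess_sup_inf.
From mathcomp Require Import ring lra.
Import Order.TTheory GRing.Theory Num.Theory.
Import numFieldNormedType.Exports.
Local Open Scope classical_set_scope.
Local Open Scope ring_scope.

(* Test the inequality on smooth approximations [u] of the indicator of the unit cube: a tensor product of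
   one-dimensional cutoffs whose transitions have width [e]. Then [u <= 1] and the gradient of [u] is [O(1 / e)] on
   boundary layers of measure [O(e)], so the right-hand side is bounded uniformly in [e]. On the left, if [h] is of order
   [l ^ (- p / (N + 1))] and [h >= 2 e], pairs [(x, y)] lying within [h] of a face and of each other, on opposite
   sides of it, are in the superlevel set of level [l], which thus has measure at least [c * l ^ (- p)]. For finite [q]
   the Lorentz integral therefore dominates a logarithmically divergent [\int dl / l] as [e -> 0]. *)

(** * Smooth functions of one real variable *)

Section smooth1.
Set Implicit Arguments.
Unset Strict Implicit.
Unset Printing Implicit Defensive.
Context {R : realType}.
Implicit Types f g : R -> R.

(** Continuity is asked only at order 0, since derivability yields it at the higher orders. *)
Fixpoint C1_k (k : nat) f : Prop :=
  match k with
  | 0 => continuous f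
  | k'.+1 => (forall x, derivable f x 1) /\ C1_k k' (derive1 f)
  end.

Definition smooth1 f := forall k, C1_k k f.

Lemma derivable1_continuous f : (forall x, derivable f x 1) -> continuous f.
Proof. by move=> df x; apply/differentiable_continuous/derivable1_diffP. Qed.

Lemma C1_kS k f : C1_k k.+1 f -> C1_k k f.
Proof.
elim: k f => [|k IHk] f [df Cf]; first exact: derivable1_continuous.
by split=> //; exact: IHk.
Qed.

(** Lets the inductions on [k] work with an explicit formula for the derivative in place of
    [derive1 f]. *)
Lemma C1_kSP k f g : (forall x : R, is_derive x 1 f (g x)) ->
  C1_k k g -> C1_k k.+1 f.
Proof.
move=> dfg Cg; split=> [x|]; first exact: (@ex_derive _ _ _ _ _ _ _ (dfg x)).
suff -> : (derive1 f) = g by [].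
by apply/funext => x; rewrite derive1E; exact: (@derive_val _ _ _ _ _ _ _ (dfg x)).
Qed.

Lemma C1_k_derive k f : C1_k k.+1 f ->
  (forall x : R, is_derive x 1 f ((derive1 f) x)) /\ C1_k k (derive1 f).
Proof.
by move=> [df Cf]; split=> // x; rewrite derive1E; exact/derivableP.
Qed.

Lemma C1_kD k f g : C1_k k f -> C1_k k g -> C1_k k (f + g).
Proof.
elim: k f g => [|k IHk] f g; first by move=> cf cg x; exact: cvgD (cf x) (cg x).
move=> /C1_k_derive[df Cf] /C1_k_derive[dg Cg].
by apply: (@C1_kSP _ _ ((derive1 f) + (derive1 g))); exact: IHk.
Qed.

Lemma C1_kM k f g : C1_k k f -> C1_k k g -> C1_k k (f * g).
Proof.
elim: k f g => [|k IHk] f g; first by move=> cf cg x; exact: cvgM (cf x) (cg x).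
move=> Cf1 Cg1; have [df Cf] := C1_k_derive Cf1; have [dg Cg] := C1_k_derive Cg1.
apply: (@C1_kSP _ _ (f * (derive1 g) + g * (derive1 f))).
by apply: C1_kD; apply: IHk => //; exact: C1_kS.
Qed.

Lemma C1_k_comp k f g : C1_k k f -> C1_k k g -> C1_k k (f \o g).
Proof.
elim: k f g => [|k IHk] f g.
  by move=> cf cg x; apply: continuous_comp; [exact: cg|exact: cf].
move=> Cf1 Cg1; have [df Cf] := C1_k_derive Cf1; have [dg Cg] := C1_k_derive Cg1.
apply: (@C1_kSP _ _ (((derive1 f) \o g) * (derive1 g))
  (fun x => is_derive1_comp (df (g x)) (dg x))).
by apply: C1_kM => //; apply: IHk => //; exact: C1_kS.
Qed.

Lemma C1_k_cst k (c : R) : C1_k k (cst c).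
Proof.
elim: k c => [|k IHk] c; first by move=> x; exact: cst_continuous.
by apply: (@C1_kSP _ _ (cst 0)).
Qed.

Lemma C1_k_id k : C1_k k (@idfun R).
Proof.
case: k => [|k]; first by move=> x.
by apply: (@C1_kSP _ _ (cst 1)); exact: C1_k_cst.
Qed.

Lemma smooth1M f g : smooth1 f -> smooth1 g -> smooth1 (f * g).
Proof. by move=> sf sg k; exact: C1_kM. Qed.

Lemma smooth1_comp f g : smooth1 f -> smooth1 g -> smooth1 (f \o g).
Proof. by move=> sf sg k; exact: C1_k_comp. Qed.

Lemma smooth1_affine (a b : R) : smooth1 (fun t => a * t + b).
Proof.
move=> k; apply: (@C1_kD k (cst a * idfun) (cst b)); last exact: C1_k_cst.
by apply: C1_kM; [exact: C1_k_cst|exact: C1_k_id].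
Qed.

Lemma smooth1_cst (c : R) : smooth1 (cst c).
Proof. by move=> k; exact: C1_k_cst. Qed.

Lemma smooth1_derive f : smooth1 f -> smooth1 (derive1 f).
Proof. by move=> sf k; have [] := sf k.+1. Qed.

Lemma smooth1_is_derive f (x : R) : smooth1 f -> is_derive x 1 f ((derive1 f) x).
Proof. by move=> /(_ 1%N) /C1_k_derive[]. Qed.

Lemma smooth1_continuous f : smooth1 f -> continuous f.
Proof. by move=> /(_ 0%N). Qed.

End smooth1.

(** * The flat functions P(1/t) exp(-1/t), extended by 0 to t <= 0 *)

Section flat.
Set Implicit Arguments.
Unset Strict Implicit.
Unset Printing Implicit Defensive.
Context {R : realType}.
Implicit Types (P : {poly R}) (s t : R).

(** The polynomial factor makes this family stable under differentiation, so that smoothness of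
    exp(-1/t) becomes an induction with [P] arbitrary. *)
Definition flat P t : R := if 0 < t then P.[t^-1] * expR (- t^-1) else 0.

Lemma exprn_expRN_le n s : 0 <= s -> s ^+ n * expR (- s) <= n`!%:R.
Proof.
move=> s0; rewrite expRN ler_pdivrMr ?expR_gt0//; case: n => [|n].
  by rewrite expr0 fact0 mul1r (le_trans _ (expR_ge1Dx s))// lerDl.
rewrite -ler_pdivrMl ?ltr0n ?fact_gt0// mulrC.
by apply: le_trans (expR_ge1Dxn n s0); rewrite lerDr.
Qed.

Lemma poly_expRN_bounded P :
  exists2 K, 0 <= K & forall s, 0 <= s -> `|P.[s] * expR (- s)| <= K.
Proof.
(* The extra factor [s ^+ n], with [n] arbitrary in the induction, absorbs the ['X] of
   [P * 'X + c%:P]; the constant [c] leaves a monomial, already bounded. *)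
suff [K K0 H] : exists2 K, 0 <= K &
    forall s, 0 <= s -> `|s ^+ 0 * P.[s] * expR (- s)| <= K.
  by exists K => // s /H; rewrite expr0 mul1r.
elim/poly_ind: P 0%N => [|P c IHP] n.
  by exists 0 => // s _; rewrite horner0 mulr0 mul0r normr0.
have [K K0 HK] := IHP n.+1.
exists (K + `|c| * n`!%:R) => [|s s0]; first by rewrite addr_ge0// mulr_ge0.
rewrite hornerMXaddC (_ : _ * _ * _ = s ^+ n.+1 * P.[s] * expR (- s) +
  c * (s ^+ n * expR (- s))); last by rewrite exprS; ring.
rewrite (le_trans (ler_normD _ _))// lerD ?HK// normrM ler_wpM2l//.
by rewrite ger0_norm ?exprn_expRN_le// mulr_ge0 ?exprn_ge0// expR_ge0.
Qed.

(** For h > 0 the difference quotient is h times the bounded quantity h^-2 P(1/h) exp(-1/h), hence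
    at most K |h|; for h < 0 it vanishes. *)
Lemma is_derive_flat0 P : is_derive (0 : R) 1 (flat P) 0.
Proof.
have flat0 : flat P 0 = 0 by rewrite /flat ltxx.
suff H : h^-1 *: ((flat P \o shift 0) (h *: 1) - flat P 0) @[h --> 0^'] --> (0 : R).
  by split; [apply/cvg_ex; exists 0|exact: cvg_lim].
rewrite flat0; under eq_fun do rewrite /= subr0 addr0.
have [K K0 HK] := poly_expRN_bounded ('X * ('X * P)).
apply/norm_cvg0P; apply: (@squeeze_cvgr _ _ _ _ (cst 0) (fun h : R => K * `|h|)).
- near=> h; have h0 : h != 0 by near: h; exact: nbhs_dnbhs_neq.
  rewrite normr_ge0/= /flat [_ *: 1]mulr1; case: ifPn => h1; last first.
    by rewrite scaler0 normr0 mulr_ge0.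
  rewrite (_ : _ *: _ = h * (('X * ('X * P)).[h^-1] * expR (- h^-1))).
    by rewrite normrM mulrC ler_wpM2r// HK// invr_ge0 ltW.
  by rewrite !hornerM hornerX /GRing.scale/=; field.
- exact: cvg_cst.
- rewrite -[X in _ --> X](mulr0 K); apply: cvgMr.
  apply: cvg_within_filter; have : `|h| @[h --> (0 : R)] --> `|0 : R|.
    by apply: cvg_norm; exact: cvg_id.
  by rewrite normr0.
Unshelve. all: end_near.
Qed.

(** For t > 0 put s = 1/t: the derivative of P(s) exp(-s) in s is (P' - P)(s) exp(-s), and ds/dt = -
    s^2. For t < 0 the function is locally 0. *)
Lemma is_derive_flat P t : is_derive t 1 (flat P) (flat ('X * 'X * (P - P^`())) t).
Proof.
have [t0|t0|->] := ltgtP t 0; last first.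
- by rewrite {2}/flat ltxx; exact: is_derive_flat0.
- rewrite [X in is_derive _ _ _ X]/flat t0.
  apply: (@near_eq_is_derive _ _ _
    ((fun s => P.[s] * expR (- s)) \o (fun s : R => s^-1))).
    near=> s; rewrite /flat ifT//=; near: s; exact: lt_nbhsr.
  have dV : is_derive t 1 (fun s : R => s^-1) (- t ^- 2 *: 1).
    by apply: (@is_deriveV _ idfun); rewrite gt_eqF.
  pose s := t^-1.
  have dE : is_derive s 1 (fun s => P.[s] * expR (- s))
      ((P^`() - P).[s] * expR (- s)).
    have d1 : is_derive s 1 (expR \o -%R) (expR (- s) * (-1)).
      exact: is_derive1_comp.
    apply: is_derive_eq; rewrite hornerD hornerN.
    by rewrite /GRing.scale/=; ring.
  apply: (is_derive_eq (is_derive1_comp dE dV)).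
  by rewrite !hornerM !hornerX !hornerD !hornerN -/s /GRing.scale/= -exprVn -/s; ring.
- rewrite [X in is_derive _ _ _ X]/flat ltNge ltW//=.

  apply: (@near_eq_is_derive _ _ _ (cst 0)).
  near=> s; rewrite /flat ltNge ifF//; apply/negbF/ltW; near: s; exact: lt_nbhsl.
Unshelve. all: end_near.
Qed.

Lemma smooth1_flat P : smooth1 (flat P).
Proof.
move=> k; elim: k P => [|k IHk] P.
  by apply: derivable1_continuous => x; exact: (@ex_derive _ _ _ _ _ _ _ (is_derive_flat P x)).
exact: C1_kSP (is_derive_flat P) (IHk _).
Qed.
End flat.

(** * A smooth step and one-dimensional cutoffs on the unit interval *)

Section cutoff.
Set Implicit Arguments.
Unset Strict Implicit.
Unset Printing Implicit Defensive.
Context {R : realType}.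
Implicit Types (s t : R).

Lemma flat1E t : 0 < t -> flat 1 t = expR (- t^-1).
Proof. by move=> t0; rewrite /flat t0 hornerC mul1r. Qed.

Lemma flat_le0 (P : {poly R}) t : t <= 0 -> flat P t = 0.
Proof. by move=> t0; rewrite /flat ltNge t0. Qed.

Lemma flat1_ge0 t : 0 <= flat 1 t.
Proof.
by have [/flat_le0->//|t0] := leP t 0; rewrite flat1E// expR_ge0.
Qed.

Lemma flat1_le s t : s <= t -> flat 1 s <= flat 1 t.
Proof.
move=> st; have [s0|s0] := leP s 0; first by rewrite flat_le0// flat1_ge0.
have t0 := lt_le_trans s0 st.
by rewrite !flat1E// ler_expR lerN2 lef_pV2.
Qed.

(* Composing the flat function with itself yields a step without any division by a nonconstant function. *)
Definition step t : R := (flat 1 (flat 1 1))^-1 * flat 1 (flat 1 1 - flat 1 (1 - t)).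

Let flat11_gt0 : 0 < flat 1 (1 : R).
Proof. by rewrite flat1E// expR_gt0. Qed.

Let flat1flat11_gt0 : 0 < flat 1 (flat 1 (1 : R)).
Proof. by rewrite flat1E// expR_gt0. Qed.

Lemma smooth1_step : smooth1 step.
Proof.
have sflat := @smooth1_flat R 1.
have -> : step = cst (flat 1 (flat 1 1))^-1 * (flat 1 \o
    ((fun t => -1 * t + flat 1 1) \o (flat 1 \o (fun t => -1 * t + 1)))).
  by apply/funext => t; rewrite /step mulrfctE/= !mulN1r ![- _ + _]addrC.
apply: smooth1M; first exact: smooth1_cst.
apply: smooth1_comp => //; apply: smooth1_comp; first exact: smooth1_affine.
by apply: smooth1_comp => //; exact: smooth1_affine.
Qed.

Lemma step_ge0 t : 0 <= step t.
Proof. by rewrite mulr_ge0 ?invr_ge0 ?flat1_ge0. Qed.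

Lemma step_le1 t : step t <= 1.
Proof.
rewrite /step mulrC ler_pdivrMr// mul1r flat1_le// lerBlDr lerDl.
exact: flat1_ge0.
Qed.

Lemma step_le0 t : t <= 0 -> step t = 0.
Proof.
move=> t0; rewrite /step [X in _ * X]flat_le0 ?mulr0// subr_le0 flat1_le//.
by rewrite lerDl oppr_ge0.
Qed.

Lemma step_ge1 t : 1 <= t -> step t = 1.
Proof.
move=> t1; rewrite /step (@flat_le0 _ (1 - t)) ?subr_le0//.
by rewrite subr0 mulVf// gt_eqF.
Qed.

Lemma derive1_step_eq0 t : t < 0 \/ 1 < t -> derive1 step t = 0.
Proof.
move=> t01; suff [c tc] : exists c : R, \near t, cst c t = step t.
  rewrite derive1E.
  exact: (@derive_val _ _ _ _ _ _ _ (near_eq_is_derive tc (is_derive_cst c t 1))).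
case: t01 => t0; [exists 0|exists 1]; near=> s; rewrite /=.
  by rewrite step_le0// ltW//; near: s; exact: lt_nbhsl.
by rewrite step_ge1// ltW//; near: s; exact: lt_nbhsr.
Unshelve. all: end_near.
Qed.

(** The derivative is continuous, hence bounded on [0, 1], and vanishes elsewhere. *)
Lemma derive1_step_bounded : exists2 M : R, 0 <= M & forall t, `|derive1 step t| <= M.
Proof.
have cstep : continuous (fun t => `|derive1 step t|).
  move=> t; apply: cvg_norm; apply: smooth1_continuous.
  exact/smooth1_derive/smooth1_step.
have [c _ Hc] := @EVT_max R _ 0 1 ler01 (continuous_subspaceT cstep).
exists `|derive1 step c| => [|t]; first exact: normr_ge0.
have [t0|t0] := ltP t 0; first by rewrite derive1_step_eq0 ?normr0//; left.
have [t1|t1] := ltP 1 t; first by rewrite derive1_step_eq0 ?normr0//; right.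
by apply: Hc; rewrite in_itv/= t0.
Qed.

(** The cutoff is [step (t / e) * step ((1 - t) / e)]. Rescaling costs a factor 1 / e in the
    derivative and nothing else, so [M] is fixed before [e]; it is twice the bound for [step], one
    for each term of the product rule. *)
Lemma exists_cutoff : exists2 M : R, 0 <= M & forall e : R, 0 < e ->
  exists f : R -> R, [/\ smooth1 f, forall t, 0 <= f t <= 1,
    forall t, f t != 0 -> 0 < t < 1, forall t, e <= t <= 1 - e -> f t = 1 &
    forall t, `|derive1 f t| <= M / e /\ (derive1 f t != 0 -> 0 <= t <= e \/ 1 - e <= t <= 1)].
Proof.
have [M M0 HM] := derive1_step_bounded; exists (2 * M) => [|e e0].
  by rewrite mulr_ge0.
pose a t := e^-1 * t + 0; pose b t := - e^-1 * t + e^-1.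
have aE t : a t = t / e by rewrite /a addr0 mulrC.
have bE t : b t = (1 - t) / e by rewrite /b; field; rewrite gt_eqF.
have sa : smooth1 a by exact: smooth1_affine.
have sb : smooth1 b by exact: smooth1_affine.
exists ((step \o a) * (step \o b)).
have da t : is_derive t 1 a e^-1.
  by apply: is_derive_eq; rewrite addr0 /GRing.scale/= mulr1.
have db t : is_derive t 1 b (- e^-1).
  by apply: is_derive_eq; rewrite addr0 /GRing.scale/= mulr1.
have dE t : derive1 ((step \o a) * (step \o b)) t =
    step (b t) * (derive1 step (a t) * e^-1) - step (a t) * (derive1 step (b t) * e^-1).
  have dstep s := smooth1_is_derive s smooth1_step.
  rewrite derive1E (@derive_val _ _ _ _ _ _ _ (is_deriveM
    (is_derive1_comp (dstep (a t)) (da t)) (is_derive1_comp (dstep (b t)) (db t)))).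
  by rewrite addrC -mulrN -mulrN.
split.
- by apply: smooth1M; apply: smooth1_comp => //; exact: smooth1_step.
- move=> t; rewrite /GRing.mul/= mulr_ge0 ?step_ge0//=.
  by rewrite mulr_ile1 ?step_ge0 ?step_le1.
- move=> t; rewrite /GRing.mul/= mulf_eq0 negb_or => /andP[ta tb].
  apply/andP; split; rewrite ltNge.
    by apply: contra ta => t0; rewrite step_le0// aE mulr_le0_ge0// invr_ge0 ltW.
  apply: contra tb => t0; rewrite step_le0// bE mulr_le0_ge0 ?subr_le0//.
  by rewrite invr_ge0 ltW.
- move=> t /andP[et te]; rewrite /GRing.mul/= !step_ge1 ?mulr1//.
    by rewrite bE ler_pdivlMr// mul1r; lra.
  by rewrite aE ler_pdivlMr// mul1r.
- move=> t; rewrite dE; split.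
    have bound r s : `|step r * (derive1 step s * e^-1)| <= M / e.
      rewrite normrM (ger0_norm (step_ge0 r)) normrM.
      rewrite (@ger0_norm _ e^-1) ?invr_ge0 ?(ltW e0)// -[leRHS]mul1r.
      rewrite ler_pM ?step_ge0 ?step_le1 ?mulr_ge0 ?invr_ge0 ?(ltW e0)//.
      by rewrite ler_wpM2r ?invr_ge0 ?(ltW e0).
    apply: (le_trans (ler_normB _ _)); rewrite -mulrA [2 * _]mulr_natl mulr2n; exact: lerD (bound _ _) (bound _ _).
  (* Off both transition layers, [a t] and [b t] lie outside [0, 1], where [derive1 step] vanishes,
     so both terms of the product rule are 0. *)
  apply: contraPP => /not_orP[/negP ta /negP tb].
  have -> : derive1 step (a t) = 0.
    apply: derive1_step_eq0; rewrite aE; move: ta.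
    rewrite negb_and -!ltNge => /orP[t0|t0]; [left|right].
      by rewrite pmulr_llt0// invr_gt0.
    by rewrite ltr_pdivlMr// mul1r.
  have -> : derive1 step (b t) = 0.
    apply: derive1_step_eq0; rewrite bE; move: tb.
    rewrite negb_and -!ltNge => /orP[t0|t0]; [right|left].
      by rewrite ltr_pdivlMr// mul1r; lra.
    by rewrite pmulr_llt0 ?invr_gt0// subr_lt0.
  by rewrite (mul0r e^-1) (mulr0 (step (a t))) (mulr0 (step (b t))) subrr eqxx.
Qed.
End cutoff.

(** * Tensor products of one-variable functions *)

Section tensor.
Set Implicit Arguments.
Unset Strict Implicit.
Unset Printing Implicit Defensive.
Context {R : realType} {N : nat}.
Implicit Types (f : 'I_N -> R -> R) (x : 'rV[R]_N).

Definition tensor f x : R := \prod_i f i (x ord0 i).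

(** A partial derivative of a tensor product is again a tensor product, which drives the induction
    in [smooth_tensor]. *)
Definition derive_factor f i : 'I_N -> R -> R :=
  fun j => if j == i then derive1 (f j) else f j.

Lemma continuous_tensor f : (forall i, continuous (f i)) -> continuous (tensor f).
Proof.
move=> cf; apply: continuous_big => [|i _ x]; first exact: mul_continuous.
by apply: continuous_comp; [exact: coord_continuous|exact: cf].
Qed.

(** Along the i-th axis only the i-th factor varies; the others form the constant [c]. *)
Lemma is_derive_tensor f i x : (forall j, smooth1 (f j)) ->
  is_derive x (delta_mx ord0 i : 'rV[R]_N) (tensor f) (tensor (derive_factor f i) x).
Proof.
move=> sf; pose c := \prod_(j | j != i) f j (x ord0 j).
have dfi := smooth1_is_derive (x ord0 i) (sf i).
have tE (h : R) : tensor f (h *: delta_mx ord0 i + x) = c * f i (h + x ord0 i).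
  rewrite /tensor (bigD1 i)//= mulrC; congr (_ * f i _); last first.
    by rewrite !mxE !eqxx mulr1.
  by apply: eq_bigr => j ji; rewrite !mxE (negbTE ji) andbF mulr0 add0r.
have -> : tensor (derive_factor f i) x = c * derive1 (f i) (x ord0 i).
  rewrite /tensor (bigD1 i)//= mulrC {2}/derive_factor eqxx; congr (_ * _).
  by apply: eq_bigr => j ji; rewrite /derive_factor (negbTE ji).
have H : h^-1 *: ((tensor f \o shift x) (h *: (delta_mx ord0 i : 'rV[R]_N)) - tensor f x)
    @[h --> 0^'] --> c * derive1 (f i) (x ord0 i).
  have -> : (fun h : R => h^-1 *: ((tensor f \o shift x) (h *: (delta_mx ord0 i : 'rV[R]_N)) - tensor f x))
    = (fun h => c * (h^-1 *: ((f i \o shift (x ord0 i)) (h *: 1) - f i (x ord0 i)))).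
    apply/funext => h /=; rewrite tE -[in tensor f x](add0r x) -(scale0r (delta_mx ord0 i)) tE.
    by rewrite add0r -mulrBr [h *: 1]mulr1 /GRing.scale/= mulrCA.
  apply: cvgMr; rewrite derive1E; exact: (@ex_derive _ _ _ _ _ _ _ dfi).
by split; [apply/cvg_ex; eexists; exact: H|exact: cvg_lim H].
Qed.

Lemma partial_tensor f i : (forall j, smooth1 (f j)) ->
  partial i (tensor f) = tensor (derive_factor f i).
Proof.
move=> sf; apply/funext => x.
exact: (@derive_val _ _ _ _ _ _ _ (is_derive_tensor i x sf)).
Qed.

Lemma smooth_tensor f : (forall j, smooth1 (f j)) -> smooth (tensor f).
Proof.
move=> sf k; elim: k f sf => [|k IHk] f sf.
  by apply: continuous_tensor => i; exact: smooth1_continuous.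
split=> [|i]; first by apply: continuous_tensor => i; exact: smooth1_continuous.
split=> [x|]; first exact: (@ex_derive _ _ _ _ _ _ _ (is_derive_tensor i x sf)).
rewrite partial_tensor//; apply: IHk => j; rewrite /derive_factor.
by case: ifPn => // _; exact: smooth1_derive.
Qed.

Lemma measurable_tensor f : (forall i, continuous (f i)) ->
  measurable_fun [set: 'rV[measurableTypeR R]_N] (tensor f).
Proof.
move=> cf; apply: measurable_prod => i _.
apply: measurableT_comp; first exact: continuous_measurable_fun.
exact: (@measurable_coord _ (measurableTypeR R)).
Qed.

End tensor.

(** * Monotonicity of integrals of nonnegative functions *)

Section le_integral.
Local Open Scope ereal_scope.

(** The integral of a nonnegative function, measurable or not, is a supremum over the simple
    functions below it. This serves integrands such as the one in [lorentz], whose measurability is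
    never established. *)
Lemma ge0_le_integral_all d (T : measurableType d) (R : realType)
    (mu : {measure set T -> \bar R}) (D : set T) (f g : T -> \bar R) :
  (forall x, D x -> 0 <= f x) -> (forall x, D x -> f x <= g x) ->
  \int[mu]_(x in D) f x <= \int[mu]_(x in D) g x.
Proof.
move=> f0 fg; rewrite integral_mkcond [leRHS]integral_mkcond.
have f0' x : 0 <= (f \_ D) x by exact: erestrict_ge0.
have fg' x : (f \_ D) x <= (g \_ D) x by exact: lee_restrict.
rewrite !ge0_integralTE// => [|x]; last exact: le_trans (fg' x).
apply: le_ereal_sup => _ [h hf <-]; exists h => // x.
exact: le_trans (fg' x).
Qed.

Lemma integral_ge_cst d (T : measurableType d) (R : realType)
    (mu : {measure set T -> \bar R}) (D : set T) (c : \bar R) (f : T -> \bar R) :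
  measurable D -> 0 <= c -> (forall x, 0 <= f x) -> (forall x, D x -> c <= f x) ->
  c * mu D <= \int[mu]_x f x.
Proof.
move=> mD c0 f0 cf; rewrite -(integral_cst mu mD) integral_mkcond.
apply: ge0_le_integral_all => x _; first exact: erestrict_ge0.
by rewrite /patch; case: ifPn => // /set_mem; exact: cf.
Qed.

End le_integral.

(** * Boxes, the Euclidean norm and measurability of the quotient *)

Section boxes.
Set Implicit Arguments.
Unset Strict Implicit.
Unset Printing Implicit Defensive.
Context {R : realType} {N : nat}.
Implicit Types (a b : 'I_N -> R) (v : 'rV[R]_N).

Definition box a b : set 'rV[R]_N := [set v | forall i, a i <= v ord0 i <= b i].

Lemma measurable_box a b : measurable (box a b).
Proof.
rewrite (_ : box a b = \bigcap_(i in [set: 'I_N])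
    (fun v : 'rV[R]_N => v ord0 i) @^-1` `[a i, b i]).
  apply: fin_bigcap_measurable => // i _; rewrite -[X in measurable X]setTI.
  exact: (@measurable_coord _ (measurableTypeR R) N i).
apply/seteqP; split=> v /= Bv i; first by move=> _; rewrite set_itvE/=; exact: Bv.
by have := Bv i Logic.I; rewrite set_itvE.
Qed.

Lemma lebesgue_rV_cbox a b : (forall i, a i <= b i) ->
  lebesgue_rV N (box a b) = (\prod_i (b i - a i))%:E.
Proof.
move=> ab; rewrite (_ : box a b = [set v | forall i, `[a i, b i]%classic (v ord0 i)]).
  rewrite (@lebesgue_rV_box R N (fun i => `[a i, b i]%classic)) => [|i]; last exact: measurable_itv.
  rewrite -prodEFin; apply: eq_bigr => i _; rewrite lebesgue_measure_itv/= lte_fin.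
  case: ltgtP (ab i) => //= -> _; by rewrite subrr.
by apply/seteqP; split=> v /= Bv i; have := Bv i; rewrite /= in_itv/=.
Qed.

(** Expanding the square of the sum, the diagonal terms alone give the squared norm. It bounds both
    distances and gradients. *)
Lemma eucl_norm_le_sum v : eucl_norm v <= \sum_i `|v ord0 i|.
Proof.
rewrite /eucl_norm -[leRHS]ger0_norm ?sumr_ge0// -sqrtr_sqr ler_wsqrtr//.
rewrite expr2 mulr_suml; apply: ler_sum => i _.
rewrite -(real_normK (num_real (v ord0 i))) expr2 ler_wpM2l// (bigD1 i)//= lerDl.
by rewrite sumr_ge0.
Qed.

Lemma measurable_eucl_norm : measurable_fun [set: 'rV[R]_N] (@eucl_norm R N).
Proof.
rewrite /eucl_norm; apply: measurableT_comp.
  by apply: continuous_measurable_fun => x; exact: sqrt_continuous.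
apply: measurable_sum => i; apply: measurable_funX.
exact: (@measurable_coord _ (measurableTypeR R)).
Qed.

Lemma measurable_quotient (p : R) (u : 'rV[R]_N -> R) :
  measurable_fun [set: 'rV[R]_N] u ->
  measurable_fun [set: 'rV[R]_N * 'rV[R]_N] (quotient p u).
Proof.
move=> mu; rewrite /quotient; under eq_fun do rewrite -powRN.
apply: measurable_funM.
  apply: measurable_funB; apply: measurableT_comp => //.
apply: (@measurableT_comp _ _ _ _ _ _ (fun x : R => x `^ _)).
  exact: measurable_powR.
apply: measurableT_comp; first exact: measurable_eucl_norm.
apply/measurable_fun_coordP => i; under eq_fun do rewrite !mxE.
by apply: measurable_funB; apply: measurableT_comp (measurable_coord i) _.
Qed.

End boxes.

(** * Lower bound for the measure of a superlevel set *)

Section level_set.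
Set Implicit Arguments.
Unset Strict Implicit.
Unset Printing Implicit Defensive.
Context {R : realType} {n : nat}.
Implicit Types (u : 'rV[R]_n.+1 -> R) (x y : 'rV[R]_n.+1).

(** Pairs straddling the face where coordinate 0 vanishes have [u x = 1], [u y = 0] and distance at
    most (n+1) 2h, so the last hypothesis puts them in the superlevel set. Their measure is of order
    h in each of the n+1 coordinates of y and once more in coordinate 0 of x. *)
Lemma lebesgue_rV_level_ge u (p e h l : R) :
  measurable_fun [set: 'rV[R]_n.+1] u ->
  (forall x, (forall i, e <= x ord0 i <= 1 - e) -> u x = 1) ->
  (forall x i, x ord0 i <= 0 -> u x = 0) ->
  0 < p -> 0 < e -> 2 * e <= h -> h <= 4^-1 ->
  l * (n.+1%:R * (2 * h)) `^ ((n.+1%:R + 1) / p) <= 1 ->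
  ((h ^+ n.+2 / 2)%:E <= (lebesgue_rV n.+1 \x lebesgue_rV n.+1)
    [set z | (l <= `|quotient p u z|)%R])%E.
Proof.
move=> mu u1 u0 p0 e0 eh h4 lh.
set E := [set z | _].
have mE : measurable E.
  rewrite (_ : E = (fun z => `|quotient p u z|) @^-1` `[l, +oo[%classic).
    rewrite -[X in measurable X]setTI; apply: measurableT_comp => //.
    exact: measurable_quotient.
  by apply/seteqP; split => z /=; rewrite in_itv/= andbT.
(* The point x ranges over [box a b], inside the cube near the middle of the face; given x, the
   point y ranges over [box (a' x) (b' x)], just outside. *)
pose a (i : 'I_n.+1) : R := if i == ord0 then e else 4^-1.
pose b (i : 'I_n.+1) : R := if i == ord0 then h else 3 / 4.
pose a' x (i : 'I_n.+1) : R := if i == ord0 then - h else x ord0 i - h.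
pose b' x (i : 'I_n.+1) : R := if i == ord0 then 0 else x ord0 i + h.
have ab i : a i <= b i by rewrite /a /b; case: ifPn => _; lra.
have ab' x i : a' x i <= b' x i by rewrite /a' /b'; case: ifPn => _; lra.
have sub x y : box a b x -> box (a' x) (b' x) y -> E (x, y).
  move=> abx aby; rewrite /E/= /quotient/= u1; last first.
    by move=> i; have := abx i; rewrite /a /b; case: ifPn => _; lra.
  have x0 : e <= x ord0 ord0 <= h by have := abx ord0; rewrite /a /b eqxx.
  have y0 : - h <= y ord0 ord0 <= 0 by have := aby ord0; rewrite /a' /b' eqxx.
  rewrite (u0 y ord0) ?subr0 ?mul1r; last by case/andP: y0.
  set d := eucl_norm _.
  have d0 : 0 < d.
    rewrite /d /eucl_norm sqrtr_gt0 (bigD1 ord0)//= ltr_wpDr//.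
      by rewrite sumr_ge0// => i _; exact: sqr_ge0.
    by rewrite !mxE exprn_gt0//; lra.
  have dh : d <= n.+1%:R * (2 * h).
    apply: (le_trans (eucl_norm_le_sum _)).
    rewrite (_ : n.+1%:R * _ = \sum_(i < n.+1) (2 * h)); last first.
      by rewrite sumr_const card_ord mulr_natl.
    apply: ler_sum => i _; rewrite !mxE ler_norml.
    have [->|i0] := eqVneq i ord0; first by apply/andP; split; lra.
    have := aby i; rewrite /a' /b' (negbTE i0) => yi.
    by apply/andP; split; lra.
  rewrite ger0_norm ?invr_ge0 ?powR_ge0//.
  rewrite -[leRHS]mul1r ler_pdivlMr ?powR_gt0//.
  have [l0|l0] := leP l 0.
    by rewrite (le_trans _ ler01)// mulr_le0_ge0// powR_ge0.
  apply: le_trans lh; rewrite ler_wpM2l// ?(ltW l0)//.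
  rewrite ge0_ler_powR// ?nnegrE ?(ltW d0)//.
    by rewrite divr_ge0// ltW.
  exact: le_trans (ltW d0) dh.
rewrite /product_measure1.
have prodE (g k : R) : \prod_(i < n.+1) (if i == ord0 then g else k) = g * k ^+ n.
  by rewrite big_ord_recl/= prodr_const card_ord.
(* The y-box has measure h (2h)^n and the x-box (h - e) 2^-n; the powers of 2 cancel, and
   [2 * e <= h] gives h - e >= h / 2. *)
apply: (@le_trans _ _ ((h * (2 * h) ^+ n)%:E * lebesgue_rV n.+1 (box a b))%E).
  rewrite lebesgue_rV_cbox// -EFinM lee_fin.
  rewrite (eq_bigr (fun i => if i == ord0 then h - e else 2^-1)); last first.
    by move=> i _; rewrite /a /b; case: ifPn => // _; lra.
  rewrite prodE mulrACA -exprMn (_ : 2 * h / 2 = h); last by lra.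
  have h0 : 0 <= h by lra.
  rewrite [leRHS]mulrC !exprSr -!mulrA ler_wpM2l ?exprn_ge0// ler_wpM2l//; lra.
apply: integral_ge_cst.
- exact: measurable_box.
- by rewrite lee_fin mulr_ge0 ?exprn_ge0//; lra.
- by move=> x; exact: measure_ge0.
move=> x abx /=.
apply: (@le_trans _ _ (lebesgue_rV n.+1 (box (a' x) (b' x)))).
  rewrite lebesgue_rV_cbox// lee_fin.
  rewrite (eq_bigr (fun i => if i == ord0 then h else 2 * h)) ?prodE//.
  by move=> i _; rewrite /a' /b'; case: ifPn => // _; lra.
apply: le_measure; rewrite ?inE.
- exact: measurable_box.
- exact: measurable_xsection.
- by move=> y aby; apply/xsectionP; exact: sub.
Qed.

End level_set.

(** * Logarithmic lower bound for the Lorentz quasi-norm *)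

Section lorentz_lower_bound.
Set Implicit Arguments.
Unset Strict Implicit.
Unset Printing Implicit Defensive.
Context {R : realType}.

Lemma integral_inv (a b : R) : 0 < a -> a < b ->
  (\int[lebesgue_measure]_(x in `[a, b]) (x^-1)%:E = (ln b - ln a)%:E)%E.
Proof.
move=> a0 ab.
have pos x : x \in `[a, b] -> 0 < x.
  by rewrite in_itv/= => /andP[ax _]; exact: lt_le_trans ax.
have cln x : 0 < x -> {for x, continuous (@ln R)} by move=> x0; exact: continuous_ln.
rewrite (@continuous_FTC2 _ _ (@ln R))//.
- apply: continuous_in_subspaceT => x /set_mem/= xab.
  by apply: continuousV; rewrite ?gt_eqF// pos.
- split.
  + move=> x xab; apply: ex_derive; apply: is_derive1_ln.
    by apply: pos; exact: subset_itv_oo_cc.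
  + by apply: cvg_at_right_filter; exact: cln.
  + by apply: cvg_at_left_filter; apply: cln; exact: lt_trans ab.
- move=> x xab; rewrite derive1E; apply: derive_val; apply: is_derive1_ln.
  by apply: pos; exact: subset_itv_oo_cc.
Qed.

(** Level measures of size c l^-p contribute l^r (c l^-p)^(r/p) = c^(r/p), free of l, so what
    remains on [a, b] is the integral of dl / l. *)
Lemma lorentz_ge d (T : measurableType d) (mu : set T -> \bar R)
    (p r c a b : R) (f : T -> R) :
  0 < p -> 0 < r -> 0 <= c -> 0 < a -> a < b ->
  (forall l, a <= l <= b ->
    ((c * l `^ (- p))%:E <= mu [set z | (l <= `|f z|)%R])%E) ->
  (((p * (c `^ (r / p) * (ln b - ln a))) `^ r^-1)%:E <= lorentz mu p r%:E f)%E.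
Proof.
move=> p0 r0 c0 a0 ab Hl; rewrite /lorentz -poweR_EFin.
have lnab : 0 <= ln b - ln a by rewrite subr_ge0 ler_ln ?posrE ?ltW// (lt_trans a0).
apply: gt0_ler_poweR; rewrite ?invr_ge0 ?(ltW r0)//.
- rewrite in_itv/= andbC leey/= lee_fin.
  by rewrite mulr_ge0 ?(ltW p0)// mulr_ge0// powR_ge0.
- rewrite in_itv/= andbC leey/= mule_ge0 ?lee_fin ?(ltW p0)//.
  apply: integral_ge0 => l /=; rewrite in_itv/= andbT => l0.
  by rewrite !mule_ge0 ?poweR_ge0// lee_fin ?powR_ge0// invr_ge0 ltW.
rewrite EFinM lee_wpmul2l ?lee_fin ?(ltW p0)//.
rewrite EFinM -integral_inv// -ge0_integralZl//; last 3 first.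
- apply/measurable_EFinP; apply: subspace_continuous_measurable_fun => //.
  apply: continuous_in_subspaceT => x /set_mem/=; rewrite in_itv/= => /andP[ax _].
  by apply: continuousV => //; rewrite gt_eqF// (lt_le_trans a0).
- by move=> x /=; rewrite in_itv/= => /andP[ax _]; rewrite lee_fin invr_ge0 (le_trans _ ax)// ltW.
- by rewrite lee_fin powR_ge0.
rewrite integral_mkcond [leRHS]integral_mkcond.
have inv_ge0 l : a <= l -> 0 <= l^-1.
  by move=> al; rewrite invr_ge0 (le_trans _ al)// ltW.
apply: ge0_le_integral_all => l _.
  apply: erestrict_ge0 => x /=; rewrite in_itv/= => /andP[ax _].
  by rewrite mule_ge0// lee_fin ?powR_ge0 ?inv_ge0.
rewrite /patch; case: ifPn => [/set_mem/=|_]; last first.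
  case: ifPn => // /set_mem/=; rewrite in_itv/= andbT => l0.
  by rewrite !mule_ge0 ?poweR_ge0// lee_fin ?powR_ge0// invr_ge0 ltW.
rewrite in_itv/= => lab; have /andP[al lb] := lab.
have l0 : 0 < l := lt_le_trans a0 al.
rewrite mem_set ?in_itv/= ?in_itv/= ?l0//.
rewrite lee_wpmul2r ?lee_fin ?inv_ge0//.
apply: (@le_trans _ _ ((l `^ r)%:E * ((c * l `^ (- p))%:E `^ (r / p))))%E.
  rewrite poweR_EFin -EFinM lee_fin powRM ?powR_ge0// -powRrM mulrCA.
  rewrite -powRD; last by rewrite (gt_eqF l0) implybT.
  rewrite (_ : r + - p * (r / p) = 0) ?powRr0 ?mulr1//.
  by field; rewrite gt_eqF.
rewrite lee_wpmul2l ?lee_fin ?powR_ge0//.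
have c_ge0 : 0 <= c * l `^ (- p) by rewrite mulr_ge0 ?powR_ge0.
apply: gt0_ler_poweR; rewrite ?divr_ge0 ?(ltW p0) ?(ltW r0) ?Hl//.
  by rewrite in_itv/= leey andbT lee_fin.
by rewrite in_itv/= leey andbT (le_trans _ (Hl _ lab))// lee_fin.
Qed.

End lorentz_lower_bound.

(** * Norms of the cube cutoff and of its gradient *)

Section cutoff_cube.
Set Implicit Arguments.
Unset Strict Implicit.
Unset Printing Implicit Defensive.
Context {R : realType} {N : nat} (f : R -> R) (sf : smooth1 f)
  (f01 : forall t, 0 <= f t <= 1) (supp_f : forall t, f t != 0 -> 0 < t < 1).

Let u : 'rV[R]_N -> R := tensor (fun=> f).

Lemma tensor_ge0_le1 (g : 'I_N -> R -> R) (x : 'rV[R]_N) :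
  (forall i t, 0 <= g i t <= 1) -> 0 <= tensor g x <= 1.
Proof.
move=> g01; rewrite prodr_ge0 => [|i _]; last by case/andP: (g01 i (x ord0 i)).
by apply: Num.Theory.prodr_ile1 => i _; exact: g01.
Qed.

Lemma tensor_eq0 (x : 'rV[R]_N) i : x ord0 i <= 0 -> u x = 0.
Proof.
move=> x0; rewrite /u /tensor (bigD1 i)//= (_ : f _ = 0) ?mul0r//.
by apply/eqP/negP => /negP /supp_f; rewrite ltNge x0.
Qed.

Lemma Cc_infty_tensor : Cc_infty u.
Proof.
split; first by apply: smooth_tensor => _; exact: sf.
have cbox := @rV_compact _ N (fun=> `[0, 1 : R]%classic) (fun=> @segment_compact R 0 1).
refine (@subclosed_compact _ _ _ (@closed_closure _ _) cbox _).
rewrite [X in _ `<=` X](closure_id _).1; last first.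
  by apply: compact_closed => //; exact: norm_hausdorff.
apply: closure_subset => x /= ux i; rewrite /= in_itv/=.
have /supp_f/andP[/ltW-> /ltW->//] : f (x ord0 i) != 0.
by move: ux => /prodf_neq0; exact.
Qed.

Lemma Lnorm_infty_tensor_le1 : ('N[lebesgue_rV N]_+oo[EFin \o u] <= 1)%E.
Proof.
rewrite unlock; case: ifPn => // _; apply/ess_supP; apply: nearW => x /=.
have /andP[u0 u1] := @tensor_ge0_le1 (fun=> f) x (fun _ => f01).
by rewrite lee_fin ger0_norm.
Qed.

Section gradient.
Context (K e : R) (e0 : 0 < e)
  (df_le : forall t, `|derive1 f t| <= K / e)
  (supp_df : forall t, derive1 f t != 0 -> 0 <= t <= e \/ 1 - e <= t <= 1).

(** [lower i] and [upper i] are the slabs of thickness [e] along the two faces orthogonal to axis i;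
    the i-th partial derivative vanishes off them. *)
Let lower i : set 'rV[R]_N := box (fun=> 0) (fun j => if j == i then e else 1).
Let upper i : set 'rV[R]_N := box (fun j => if j == i then 1 - e else 0) (fun=> 1).

Let prodE i : \prod_(j < N) (if j == i then e else 1) = e.
Proof.
rewrite (bigD1 i)//= eqxx big1 ?mulr1// => j ji.
by rewrite (negbTE ji).
Qed.

Let lebesgue_lower i : lebesgue_rV N (lower i) = e%:E.
Proof.
rewrite lebesgue_rV_cbox => [|j]; last by case: ifPn => _; rewrite ?ler01 ?(ltW e0).
by congr EFin; rewrite -[RHS](prodE i); apply: eq_bigr => j _; rewrite subr0.
Qed.

Let lebesgue_upper i : lebesgue_rV N (upper i) = e%:E.
Proof.
rewrite lebesgue_rV_cbox => [|j]; last first.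
  by case: ifPn => _; rewrite ?ler01// gerBl ltW.
congr EFin; rewrite -[RHS](prodE i); apply: eq_bigr => j _.
by case: ifPn => _; rewrite ?subr0// opprB addrC subrK.
Qed.

Lemma partial_tensor_le i (x : 'rV[R]_N) :
  `|partial i u x| <= K / e * (\1_(lower i) x + \1_(upper i) x).
Proof.
have Ke : 0 <= K / e := le_trans (normr_ge0 _) (df_le 0).
have -> : partial i u x = derive1 f (x ord0 i) * \prod_(j | j != i) f (x ord0 j).
  rewrite (partial_tensor i (fun=> sf)) /tensor (bigD1 i) //.
  congr (_ * _); first by rewrite /derive_factor eqxx.
  by apply: eq_bigr => j ji; rewrite /derive_factor (negbTE ji).
rewrite normrM.
have [->|df0] := eqVneq (derive1 f (x ord0 i)) 0.
  by rewrite normr0 mul0r mulr_ge0 ?addr_ge0.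
(* When this product is nonzero, the support of [f] confines every other coordinate to [0, 1], which
   places x in one of the slabs. *)
have [->|h0] := eqVneq (\prod_(j | j != i) f (x ord0 j)) 0.
  by rewrite normr0 mulr0 mulr_ge0 ?addr_ge0.
have fx j : j != i -> 0 <= x ord0 j <= 1.
  by move=> ji; have /prodf_neq0/(_ j ji)/supp_f/andP[/ltW-> /ltW->] := h0.
rewrite ler_pM ?normr_ge0//; apply: (@le_trans _ _ 1).
  rewrite ger0_norm; last by apply: prodr_ge0 => j _; case/andP: (f01 (x ord0 j)).
  by apply: Num.Theory.prodr_ile1 => j _; exact: f01.
rewrite !indicE; case: (supp_df df0) => xi.
  rewrite (mem_set (_ : lower i x)) ?lerDl// => j.
  by have [->//|/fx] := eqVneq j i.
rewrite (mem_set (_ : upper i x)) ?lerDr// => j.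
by have [->//|/fx] := eqVneq j i.
Qed.

(** Each direction contributes at most K / e on two slabs of measure e, that is 2 K: the width [e]
    cancels. *)
Lemma Lnorm1_grad_tensor_le :
  ('N[lebesgue_rV N]_1[EFin \o (@eucl_norm R N \o grad u)] <= (N%:R * (2 * K))%:E)%E.
Proof.
have Ke : 0 <= K / e := le_trans (normr_ge0 _) (df_le 0).
pose B i := \1_(lower i) \+ \1_(upper i) : 'rV[R]_N -> R.
have mB i : measurable_fun [set: 'rV[R]_N] (B i).
  by apply: measurable_funD; apply: measurable_indic; exact: measurable_box.
rewrite Lnorm1.
apply: (@le_trans _ _ (\int[lebesgue_rV N]_x
    (\sum_(i < N) (K / e)%:E * (B i x)%:E))%E).
  apply: ge0_le_integral_all => x _; first exact: abse_ge0.
  rewrite (eq_bigr (fun i => (K / e * B i x)%:E)) // sumEFin /= lee_fin.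
  rewrite ger0_norm ?sqrtr_ge0//.
  apply: le_trans (eucl_norm_le_sum _) _; apply: ler_sum => i _.
  by rewrite mxE; exact: partial_tensor_le.
rewrite ge0_integral_sum//; last 2 first.
- by move=> i; apply/measurable_EFinP; exact: measurable_funM.
- by move=> i x _; rewrite lee_fin mulr_ge0 ?addr_ge0.
rewrite (eq_bigr (fun=> (2 * K)%:E)) => [|i _].
  by rewrite sumEFin sumr_const card_ord -[(2 * K) *+ _]mulr_natl.
have ml : measurable (lower i) by exact: measurable_box.
have mu : measurable (upper i) by exact: measurable_box.
rewrite ge0_integralZl//; last 2 first.
- exact/measurable_EFinP.
- by move=> x _; rewrite lee_fin addr_ge0.
under eq_integral do rewrite /B EFinD.
rewrite ge0_integralD//; last 2 first.
- by apply/measurable_EFinP; exact: measurable_indic.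
- by apply/measurable_EFinP; exact: measurable_indic.
rewrite !integral_indic// !setIT. 
transitivity ((K / e)%:E * (e%:E + e%:E))%E.
  by congr (_ * (_ + _))%E; [exact: lebesgue_lower|exact: lebesgue_upper].
by rewrite -EFinD -EFinM; congr EFin; field; rewrite gt_eqF.
Qed.

End gradient.
End cutoff_cube.

(** * Divergence of the Lorentz quasi-norms as the transition width shrinks *)

Section lorentz_unbounded.
Set Implicit Arguments.
Unset Strict Implicit.
Unset Printing Implicit Defensive.
Context {R : realType} (n : nat) (p r : R) (p1 : 1 <= p) (r1 : 1 <= r).

Let p0 : 0 < p := lt_le_trans ltr01 p1.
Let r0 : 0 < r := lt_le_trans ltr01 r1.
(** [s] is the exponent of the distance in [quotient], and [k * h] is the distance bound used in
    [lebesgue_rV_level_ge]. *)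
Let s : R := (n.+1%:R + 1) / p.
Let s0 : 0 < s. Proof. by rewrite divr_gt0// ltr_wpDr. Qed.
Let k : R := 2 * n.+1%:R.
Let k2 : 2 <= k. Proof. by rewrite ler_peMr// ler1n. Qed.
Let k0 : 0 < k. Proof. exact: lt_le_trans k2. Qed.

(* The width of the strip around the boundary in which level [l] is attained: [l * (k * width l) `^ s = 1]. *)
Let width (l : R) : R := (l `^ s^-1)^-1 / k.

Let width_gt0 (l : R) : 0 < l -> 0 < width l.
Proof. by move=> l0; rewrite divr_gt0// invr_gt0 powR_gt0. Qed.

Let le_width (l b : R) : 0 < l -> l <= b -> width b <= width l.
Proof.
move=> l0 lb; have b0 := lt_le_trans l0 lb.
rewrite ler_pM2r ?invr_gt0// lef_pV2 ?posrE ?powR_gt0//.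
apply: ge0_ler_powR => //; rewrite ?nnegrE ?(ltW l0) ?(ltW b0)// invr_ge0; exact: ltW.
Qed.

(** At the level 2^s the width is 1 / (2 k), and k >= 2. *)
Let width_le (l : R) : 2 `^ s <= l -> width l <= 4^-1.
Proof.
move=> al; have a0 : 0 < (2 : R) `^ s by rewrite powR_gt0.
apply: (le_trans (le_width a0 al)); rewrite /width -powRrM divff ?gt_eqF//.
rewrite powRr1// -invfM lef_pV2 ?posrE ?mulr_gt0//.
by have := k2; lra.
Qed.

Let width_eq (l : R) : 0 < l -> l * (k * width l) `^ s = 1.
Proof.
move=> l0; rewrite /width mulrCA divff ?gt_eqF// mulr1 -powRN -powRrM mulNr.
by rewrite mulVf ?gt_eqF// powRN powRr1 ?divff ?gt_eqF// ltW.
Qed.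

(** The exponent (N + 1) / p is critical here: (n + 2) / s = p, so the measure bound decays exactly
    like l^-p. *)
Let width_exp (l : R) : 0 < l -> width l ^+ n.+2 / 2 = (2 * k ^+ n.+2)^-1 * l `^ (- p).
Proof.
move=> l0; rewrite /width exprMn -powRN -[(_ `^ _) ^+ _]powR_mulrn ?powR_ge0// -powRrM.
rewrite (_ : - s^-1 * n.+2%:R = - p); last first.
  rewrite /s invf_div -natr1; field.
  by rewrite gt_eqF.
by rewrite exprVn (invfM 2) mulrC [_ `^ _ * _]mulrC mulrA.
Qed.

Lemma lorentz_quotient_unbounded (Y : R) : 0 <= Y ->
  exists2 e : R, 0 < e & forall u : 'rV[R]_n.+1 -> R,
    measurable_fun [set: 'rV[R]_n.+1] u ->
    (forall x : 'rV[R]_n.+1, (forall i, e <= x ord0 i <= 1 - e) -> u x = 1) ->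
    (forall (x : 'rV[R]_n.+1) i, x ord0 i <= 0 -> u x = 0) ->
  (Y%:E < lorentz (lebesgue_rV n.+1 \x lebesgue_rV n.+1) p r%:E (quotient p u))%E.
Proof.
move=> Y0.
pose c : R := (2 * k ^+ n.+2)^-1.
have c0 : 0 < c by rewrite invr_gt0 mulr_gt0// exprn_gt0.
pose A := p * c `^ (r / p); have A0 : 0 < A by rewrite mulr_gt0// powR_gt0.
pose a : R := 2 `^ s; have a0 : 0 < a by rewrite powR_gt0.
(* [L] will be ln b - ln a; it is chosen so that the lower bound is (Y^r + 1)^(1/r), which exceeds
   Y. *)
pose L := (Y `^ r + 1) / A.
have L0 : 0 < L by rewrite divr_gt0// ltr_wpDl// powR_ge0.
pose b := a * expR L.
have ab : a < b by rewrite ltr_pMr// expR_gt1.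
have b0 := lt_trans a0 ab.
have bw0 := width_gt0 b0.
(* [width] is nonincreasing, so half its value at the top level [b] satisfies [2 * e <= width l] on
   all of [a, b]. *)
pose e := width b / 2.
have e0 : 0 < e by rewrite divr_gt0.
exists e => // u mu u1 u0.
apply: (@lt_le_trans _ _ (((p * (c `^ (r / p) * (ln b - ln a))) `^ r^-1)%:E)); last first.
  apply: lorentz_ge => //; first exact: ltW.
  move=> l /andP[al lb]; have l0 := lt_le_trans a0 al.
  rewrite -width_exp//; apply: (@lebesgue_rV_level_ge _ _ _ _ e) => //.
  - by rewrite /e mulrCA divff ?gt_eqF// mulr1; exact: le_width.
  - exact: width_le.
  - by rewrite mulrCA mulrA width_eq.
rewrite lte_fin /b lnM ?posrE ?expR_gt0// expRK addrAC subrr add0r mulrA -/A.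
rewrite mulrC divfK ?gt_eqF//.
rewrite [ltLHS](_ : Y = (Y `^ r) `^ r^-1); last first.
  by rewrite -powRrM divff ?powRr1// gt_eqF.
rewrite gt0_ltr_powR ?invr_gt0// ?nnegrE ?powR_ge0 ?addr_ge0 ?powR_ge0//.
by rewrite ltrDl.
Qed.

End lorentz_unbounded.

(** * Contradiction for finite q *)

Local Open Scope ereal_scope.

Theorem lemma4p1 (R : realType) (N : nat) (p : R) (q : \bar R)
    (hN : (1 <= N)%N) (hp : (1 <= p)%R) (hq : 1 <= q)
    (hC : exists C : R, forall u : 'rV[R]_N -> R, Cc_infty u ->
       lorentz (lebesgue_rV N \x lebesgue_rV N) p q (quotient p u) <=
       C%:E * 'N[lebesgue_rV N]_+oo[EFin \o u] `^ (1 - p^-1)%R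
            * 'N[lebesgue_rV N]_1[EFin \o (eucl_norm \o grad u)] `^ p^-1) :
  q = +oo.
Proof.
case: N hN hC => // n _ [C hC]; case: q hq hC => // r; rewrite lee_fin => r1 hC.
exfalso; have [M M0 HM] := @exists_cutoff R.
have p0 : (0 < p)%R := lt_le_trans ltr01 hp.
pose K : R := (n.+1%:R * (2 * M))%R.
(* [Y] bounds the right-hand side for every cutoff, whatever its transition width, so [e] may be
   chosen after it. The absolute value covers a negative [C]. *)
pose Y : R := (`|C| * K `^ p^-1)%R.
have Y0 : (0 <= Y)%R by rewrite mulr_ge0 ?powR_ge0.
have [e e0 lorentz_gt] := @lorentz_quotient_unbounded R n p r hp r1 Y Y0.
have [f [sf f01 suppf f1 df]] := HM e e0.
pose u : 'rV[R]_n.+1 -> R := tensor (fun=> f).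
have : Y%:E < lorentz (lebesgue_rV n.+1 \x lebesgue_rV n.+1) p r%:E (quotient p u).
  apply: lorentz_gt.
  - by apply: measurable_tensor => _; exact: smooth1_continuous.
  - by move=> x xe; rewrite /u /tensor big1// => i _; exact: f1.
  - by move=> x i; exact: tensor_eq0.
rewrite ltNge => /negP; apply.
apply: (le_trans (hC u (Cc_infty_tensor sf suppf))).
rewrite EFinM -poweR_EFin.
have Noo : 'N[lebesgue_rV n.+1]_+oo[EFin \o u] `^ (1 - p^-1)%R <= 1.
  rewrite -[leRHS](poweR1r (1 - p^-1)).
  apply: gt0_ler_poweR; rewrite ?in_itv/= ?leey ?andbT ?Lnorm_ge0 ?lee01//.
    by rewrite subr_ge0 invf_le1.
  exact: Lnorm_infty_tensor_le1.
have N1 : 'N[lebesgue_rV n.+1]_1[EFin \o (eucl_norm \o grad u)] `^ p^-1 <= K%:E `^ p^-1.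
  apply: gt0_ler_poweR; rewrite ?in_itv/= ?leey ?andbT ?Lnorm_ge0 ?invr_ge0 ?(ltW p0)//.
    by rewrite lee_fin mulr_ge0// mulr_ge0.
  by apply: (Lnorm1_grad_tensor_le sf f01 suppf e0) => t; have [] := df t.
apply: (@le_trans _ _ (`|C|%:E * 'N[lebesgue_rV n.+1]_+oo[EFin \o u] `^ (1 - p^-1)%R
    * 'N[lebesgue_rV n.+1]_1[EFin \o (eucl_norm \o grad u)] `^ p^-1)).
  by rewrite lee_wpmul2r ?poweR_ge0// lee_wpmul2r ?poweR_ge0// lee_fin ler_norm.
apply: lee_pmul N1; rewrite ?mule_ge0 ?poweR_ge0 ?lee_fin//.
by rewrite -[leRHS]mule1 lee_wpmul2l ?lee_fin.
Qed.
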